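(* Let $\{|e_i\rangle\}_{i\in I}\subset\mathcal{H}_{\{0,1\}^*}$ be a prefix-free orthonormal system, and let $\mathcal{H}\subset\mathcal{H}_{\{0,1\}^*}$ be the Hilbert space (closed subspace) spanned by it. Then $$\sum_{i\in I} 2^{-\ell(e_i)} \;\leq\; \sum_{i\in I} 2^{-\bar\ell(e_i)} \;\leq\; \mathrm{Tr}\left(2^{-\Lambda}\,\mathbb{P}(\mathcal{H})\right)\;\leq\; 1 .$$ Moreover, the three left-most expressions $\sum_{i} 2^{-\ell(e_i)}$, $\sum_i 2^{-\bar\ell(e_i)}$ and $\mathrm{Tr}(2^{-\Lambda}\mathbb{P}(\mathcal{H}))$ are all equal if and only if every $|e_i\rangle$ is a length eigenstate.
   Context: $\{0,1\}^*$ is the set of all finite binary strings, including the empty string $\lambda$; $\ell(s)$ is the length of $s\in\{0,1\}^*$, and $s\circ t$ is concatenation of classical strings. The string space is the complex Hilbert space $\mathcal{H}_{\{0,1\}^*}=\bigoplus_{n=0}^\infty(\mathbb{C}^2)^{\otimes n}$, with orthonormal basis $\{|s\rangle: s\in\{0,1\}^*\}$ (i.e. $\ell^2(\{0,1\}^* )$). Concatenation: for $|\psi\rangle=\sum_{t}\alpha_t|t\rangle\in\mathcal{H}_{\{0,1\}^*}$ and $s\in\{0,1\}^*$, $|\psi\circ s\rangle:=\sum_{t}\alpha_t|t\circ s\rangle$. A set $M\subset\mathcal{H}_{\{0,1\}^*}$ is prefix-free if $\langle\varphi|\psi\circ s\rangle=0$ for all $|\varphi\rangle,|\psi\rangle\in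 M$ (including $|\varphi\rangle=|\psi\rangle$) and all $s\in\{0,1\}^*\setminus\{\lambda\}$. $\Lambda$ is the (unbounded, self-adjoint) length operator with $\Lambda|s\rangle=\ell(s)|s\rangle$; $2^{-\Lambda}$ is the bounded operator with $2^{-\Lambda}|s\rangle=2^{-\ell(s)}|s\rangle$. $\mathbb{P}(\mathcal{H})$ is the orthogonal projector onto $\mathcal{H}$, and $\mathrm{Tr}(2^{-\Lambda}\mathbb{P}(\mathcal{H}))\in[0,\infty]$ is understood as $\sum_j\langle f_j|2^{-\Lambda}|f_j\rangle$ for any orthonormal basis $\{|f_j\rangle\}_j$ of $\mathcal{H}$. For a unit vector $|\varphi\rangle$: the base length is $\ell(\varphi):=\max\{\ell(s): s\in\{0,1\}^*,\ \langle s|\varphi\rangle\neq 0\}$, set to $\infty$ if these lengths are unbounded; the average length is $\bar\ell(\varphi):=\langle\varphi|\Lambda|\varphi\rangle=\sum_s \ell(s)|\langle s|\varphi\rangle|^2\in[0,\infty]$; and $2^{-\infty}:=0$. $|\varphi\rangle$ is a length eigenstate if $\langle s|\varphi\rangle\neq0$ only for strings $s$ of one fixed length $\ell(s)=\ell(\varphi)$. *)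

(* Defs.v *)
From HB Require Import structures.
From mathcomp Require Import all_boot all_order all_algebra.
From mathcomp Require Import complex.
From mathcomp Require Import all_classical all_reals all_analysis.

Set Implicit Arguments.
Unset Strict Implicit.
Unset Printing Implicit Defensive.

Import Order.TTheory GRing.Theory Num.Theory.
Import Normc.

Local Open Scope classical_set_scope.
Local Open Scope ring_scope.

(* A binary string is a [seq bool], with [::] for the empty string and [++] for
   concatenation.  A vector [psi] is given by its amplitudes in the basis |s>:
   [psi s] is <s|psi>.  Vectors of the Hilbert space are the families in
   [string_space] below. *)
Notation amplitudes R := (seq bool -> R[i]).

Section StringSpace.
Variable R : realType.
Implicit Types (phi psi : amplitudes R) (s u : seq bool).

Definition sqnorm psi : \bar R :=
  \esum_(s in [set: seq bool]) ((normc (psi s) ^+ 2)%:E).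

Definition string_space : set (amplitudes R) :=
  [set psi | (sqnorm psi < +oo)%E].

(* Unconditional sums of real and complex families over a choiceType.  The
   library's [esum] is only meaningful for nonnegative terms, hence the
   splitting; the result is meaningful for absolutely summable families. *)
Definition rsum (T : choiceType) (a : T -> R) : R :=
  fine (\esum_(t in [set: T]) ((a^\+ t)%:E))
  - fine (\esum_(t in [set: T]) ((a^\- t)%:E)).

Definition csum (T : choiceType) (a : T -> R[i]) : R[i] :=
  Complex (rsum (fun t => complex.Re (a t))) (rsum (fun t => complex.Im (a t))).

(* <phi|psi>, antilinear on the left; the family is absolutely summable when
   [phi] and [psi] belong to [string_space]. *)
Definition inner phi psi : R[i] := csum (fun s => conjc (phi s) * psi s).

(* |psi o s> = \sum_t psi t |t o s>: its amplitude at [u] is [psi t] if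
   [u = t ++ s] (such a [t] is unique) and [0] if [u] does not end with [s]. *)
Definition concat psi s : amplitudes R :=
  fun u => if suffix s u then psi (take (size u - size s) u) else 0.

Definition prefix_free (M : set (amplitudes R)) : Prop :=
  forall phi psi, M phi -> M psi ->
  forall s, s <> [::] -> inner phi (concat psi s) = 0.

Definition orthonormal_system (I : choiceType) (e : I -> amplitudes R) : Prop :=
  (forall i, string_space (e i)) /\
  (forall i j, inner (e i) (e j) = (i == j)%:R).

Definition lin_span (I : choiceType) (e : I -> amplitudes R) :
    set (amplitudes R) :=
  [set v | exists (r : seq I) (c : I -> R[i]),
     v = fun s => \sum_(i <- r) c i * e i s].

Definition closed_span (I : choiceType) (e : I -> amplitudes R) :
    set (amplitudes R) :=
  [set psi | string_space psi /\
     forall eps : R, 0 < eps ->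
       exists2 v, lin_span e v & (sqnorm (fun s => (psi s - v s)%R) < eps%:E)%E].

Definition orthonormal_basis (J : choiceType) (f : J -> amplitudes R)
    (V : set (amplitudes R)) : Prop :=
  orthonormal_system f /\ closed_span f = V.

(* The operator 2^(-Lambda). *)
Definition pow2NLambda psi : amplitudes R := fun s => 2 ^- size s * psi s.

(* \sum_j <f_j|A|f_j> for a positive operator [A].  For [f] an orthonormal basis
   of a closed subspace [V] this is Tr(A P(V)), [P(V)] being the orthogonal
   projector onto [V].  The terms are nonnegative reals, so [Re] loses
   nothing. *)
Definition trace_along (A : amplitudes R -> amplitudes R)
    (J : choiceType) (f : J -> amplitudes R) : \bar R :=
  \esum_(j in [set: J]) ((complex.Re (inner (f j) (A (f j))))%:E).

(* max {size s | <s|phi> <> 0}, or +oo if the lengths are unbounded: for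
   [phi <> 0] the set is a nonempty set of naturals, so its supremum is attained
   as soon as it is finite. *)
Definition base_length phi : \bar R :=
  ereal_sup [set ((size s)%:R)%:E | s in [set s | phi s != 0]].

Definition avg_length phi : \bar R :=
  \esum_(s in [set: seq bool]) (((size s)%:R * normc (phi s) ^+ 2)%:E).

Definition pow2N (x : \bar R) : \bar R :=
  match x with
  | r%:E => (2 `^ (- r))%:E
  | +oo => 0
  | -oo => +oo
  end%E.

Definition length_eigenstate phi : Prop :=
  exists n : nat, base_length phi = (n%:R)%:E /\
    forall s, phi s != 0 -> size s = n.

End StringSpace.

(* Main.v *)
(* By prefix-freeness the concatenations e_i o s, for all i and all strings s,
   form an orthonormal system.  Bessel's inequality for this system at the 2^n
   basis vectors |u> of length n gives
   \sum_i \sum_(|t| <= n) 2^(n - |t|) |<t|e_i>|^2 <= 2^n, and n -> oo yields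
   \sum_i <e_i|2^(-Lambda)|e_i> <= 1.  The left-hand side is the trace, because
   \sum_i |<u|e_i>|^2 = |P|u>|^2 does not depend on the orthonormal basis.  Jensen's
   inequality for x |-> 2^(-x) and the distribution |<u|e_i>|^2 of the length gives
   2^(-avg) <= <e_i|2^(-Lambda)|e_i>, with equality only for a constant length;
   as all sums are finite, equality of the sums is termwise equality. *)

Require Import Defs.
From HB Require Import structures.
From mathcomp Require Import all_boot all_order all_algebra.
From mathcomp Require Import complex.
From mathcomp Require Import all_classical all_reals all_analysis.
From mathcomp Require Import ring lra.

Set Implicit Arguments.
Unset Strict Implicit.
Unset Printing Implicit Defensive.

Import Order.TTheory GRing.Theory Num.Theory.
Import Normc.

Local Open Scope classical_set_scope.
Local Open Scope ring_scope.

(** * Sums of nonnegative families and unconditional sums *)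

Section EsumComplements.
Local Open Scope ereal_scope.
Variables (R : realType) (T : choiceType).
Implicit Types (a : T -> \bar R).

(** Finite subsets are replaced by duplicate-free lists, so that every later estimate of an [esum]
    is one about ordinary big sums. *)
Lemma esum_le_seq a x :
  (forall r : seq T, uniq r -> \sum_(t <- r) a t <= x) ->
  \esum_(t in [set: T]) a t <= x.
Proof.
move=> h; apply: ge_ereal_sup => _ [X [finX _] <-].
by rewrite fsbig_finite//; exact: h.
Qed.

Lemma seq_le_esum a (r : seq T) : uniq r ->
  \sum_(t <- r) a t <= \esum_(t in [set: T]) a t.
Proof.
move=> ur; apply: esum_ge; exists [set` r]; last by rewrite -fsbig_seq.
by split => //; exact: finite_seq.
Qed.

Lemma le_esum1 a t : a t <= \esum_(t in [set: T]) a t.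
Proof. by rewrite -[leLHS](big_seq1 +%E t a); exact: seq_le_esum. Qed.

Lemma esum_eq0 a : (forall t, 0 <= a t) ->
  \esum_(t in [set: T]) a t = 0 -> forall t, a t = 0.
Proof. by move=> a0 s0 t; apply/le_anti; rewrite a0 -s0 le_esum1. Qed.

Lemma esum_fin_num a x : (forall t, 0 <= a t) ->
  \esum_(t in [set: T]) a t <= x%:E -> \esum_(t in [set: T]) a t \is a fin_num.
Proof.
move=> a0 le; rewrite ge0_fin_numE; first exact: le_lt_trans le (ltry _).
exact: esum_ge0.
Qed.

(** Finite partial sums give one inequality for every factor; the other one is the same inequality
    for [c^-1]. *)
Lemma ge0_esumZl (c : R) a : (0 <= c)%R -> (forall t, 0 <= a t) ->
  \esum_(t in [set: T]) (c%:E * a t) = c%:E * \esum_(t in [set: T]) a t.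
Proof.
have half (d : R) b : (0 <= d)%R -> (forall t, 0 <= b t) ->
    \esum_(t in [set: T]) (d%:E * b t) <= d%:E * \esum_(t in [set: T]) b t.
  move=> d0 b0; apply: esum_le_seq => r ur.
  by rewrite -ge0_sume_distrr// lee_wpmul2l// seq_le_esum.
rewrite le_eqVlt => /predU1P[<- _|c0 a0].
  by rewrite mul0e esum1// => t _; rewrite mul0e.
apply/le_anti; rewrite half ?(ltW c0)//= -lee_pdivlMl//.
rewrite [leLHS](_ : _ = \esum_(t in [set: T]) (c^-1%:E * (c%:E * a t))).
  apply: half; first by rewrite invr_ge0 ltW.
  by move=> t; rewrite mule_ge0// lee_fin ltW.
by apply: eq_esum => t _; rewrite muleA -EFinM mulVf ?gt_eqF// mul1e.
Qed.

(** The family [b - a] is nonnegative, and finiteness of the sums lets its sum be computed as 0.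
    This yields the equality case of the theorem. *)
Lemma le_esum_eq a b : (forall t, 0 <= a t) -> (forall t, a t <= b t) ->
  \esum_(t in [set: T]) b t < +oo ->
  \esum_(t in [set: T]) a t = \esum_(t in [set: T]) b t ->
  forall t, a t = b t.
Proof.
move=> a0 ab bfin eqab t.
have b0 u : 0 <= b u by exact: le_trans (ab u).
have bf u : b u \is a fin_num.
  by rewrite ge0_fin_numE//; exact: le_lt_trans (le_esum1 _ _) bfin.
have af u : a u \is a fin_num.
  by rewrite ge0_fin_numE//; apply: le_lt_trans (ab u) _; rewrite -ge0_fin_numE.
have d0 u : 0 <= b u - a u by rewrite sube_ge0 ?af//.
have : \esum_(u in [set: T]) (b u - a u) = 0.
  have sf : \esum_(u in [set: T]) a u \is a fin_num.
    by rewrite eqab ge0_fin_numE//; exact: esum_ge0.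
  rewrite -(addeK (\esum_(u in [set: T]) (b u - a u)) sf) -esumD//.
  rewrite (_ : \esum_(u in [set: T]) _ = \esum_(u in [set: T]) b u).
    by rewrite -eqab subee.
  by apply: eq_esum => u _; rewrite subeK.
move=> /(esum_eq0 d0)/(_ t) ba0.
by rewrite -[RHS](subeK _ (af t)) ba0 add0e.
Qed.

End EsumComplements.

Lemma esum_exchange (R : realType) (T U : choiceType) (a : T -> U -> \bar R) :
  (forall t u, (0 <= a t u)%E) ->
  \esum_(t in [set: T]) \esum_(u in [set: U]) a t u =
  \esum_(u in [set: U]) \esum_(t in [set: T]) a t u.
Proof.
move=> a0; rewrite !esum_esum//.
rewrite (@reindex_esum _ _ _ [set: U * T] _ (fun p => (p.2, p.1))).
  have -> : [set: U] `*`` (fun _ => [set: T]) = [set: U * T].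
    by apply/seteqP; split.
  by [].
have -> : [set: T] `*`` (fun _ => [set: U]) = [set: T * U].
  by apply/seteqP; split.
split => //; first by move=> [u t] [u' t'] _ _ [-> ->].
by move=> [t u] _; exists (u, t).
Qed.

Section UnconditionalSums.
Variables (R : realType) (T : choiceType).
Implicit Types (a b p q : T -> R).

Definition abs_summable a := (\esum_(t in [set: T]) (`|a t|%:E) < +oo)%E.

Lemma esum_fin_le a b : (forall t, 0 <= a t) -> (forall t, a t <= b t) ->
  (\esum_(t in [set: T]) ((b t)%:E) < +oo)%E ->
  \esum_(t in [set: T]) ((a t)%:E) \is a fin_num.
Proof.
move=> a0 ab bf; rewrite ge0_fin_numE.
  by apply: le_lt_trans bf; apply: le_esum => t _; rewrite lee_fin.
by apply: esum_ge0 => t _; rewrite lee_fin.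
Qed.

(** Positive and negative parts are not additive; allowing any splitting into nonnegative summable
    families is what makes linearity of [rsum] accessible. Pointwise a^+ + q = a^- + p, and all four
    sums are finite. *)
Lemma rsumE p q a : (forall t, 0 <= p t) -> (forall t, 0 <= q t) ->
  (forall t, a t = p t - q t) ->
  \esum_(t in [set: T]) ((p t)%:E) \is a fin_num ->
  \esum_(t in [set: T]) ((q t)%:E) \is a fin_num ->
  rsum a = fine (\esum_(t in [set: T]) ((p t)%:E))
           - fine (\esum_(t in [set: T]) ((q t)%:E)).
Proof.
move=> p0 q0 apq pf qf; rewrite /rsum.
have pos t : 0 <= a^\+ t by exact: funrpos_ge0.
have neg t : 0 <= a^\- t by exact: funrneg_ge0.
have af t : a t = a^\+ t - a^\- t by rewrite -[in LHS](funrposBneg a).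
have lep t : a^\+ t <= p t.
  by rewrite /funrpos ge_max p0 apq lerBlDr lerDl q0.
have leq t : a^\- t <= q t.
  by rewrite /funrneg ge_max q0 apq opprB lerBlDr lerDl p0.
have pfin : \esum_(t in [set: T]) ((a^\+ t)%:E) \is a fin_num.
  by apply: (esum_fin_le pos lep); rewrite -ge0_fin_numE//
    esum_ge0// => t _; rewrite lee_fin.
have qfin : \esum_(t in [set: T]) ((a^\- t)%:E) \is a fin_num.
  by apply: (esum_fin_le neg leq); rewrite -ge0_fin_numE//
    esum_ge0// => t _; rewrite lee_fin.
have : (\esum_(t in [set: T]) ((a^\+ t)%:E) + \esum_(t in [set: T]) ((q t)%:E)
   = \esum_(t in [set: T]) ((a^\- t)%:E) + \esum_(t in [set: T]) ((p t)%:E))%E.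
  rewrite -!esumD//; try by move=> t _; rewrite lee_fin.
  apply: eq_esum => t _; rewrite -!EFinD; congr EFin.
  by have := apq t; rewrite (af t); lra.
move=> /(congr1 fine); rewrite !fineD//; lra.
Qed.

Lemma abs_summable_fin a : abs_summable a ->
  \esum_(t in [set: T]) ((a^\+ t)%:E) \is a fin_num /\
  \esum_(t in [set: T]) ((a^\- t)%:E) \is a fin_num.
Proof.
move=> aa; split; apply: esum_fin_le aa => t.
- exact: funrpos_ge0.
- by rewrite /funrpos ge_max ler_norm normr_ge0.
- exact: funrneg_ge0.
- by rewrite /funrneg ge_max -normrN ler_norm normr_ge0.
Qed.

Lemma rsumD a b : abs_summable a -> abs_summable b ->
  rsum (fun t => a t + b t) = rsum a + rsum b.
Proof.
move=> /abs_summable_fin[ap an] /abs_summable_fin[bp bn].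
have eD (x y : T -> R) : (forall t, 0 <= x t) -> (forall t, 0 <= y t) ->
    (\esum_(t in [set: T]) ((x t + y t)%:E) =
     \esum_(t in [set: T]) ((x t)%:E) + \esum_(t in [set: T]) ((y t)%:E))%E.
  by move=> x0 y0; rewrite -esumD// => t _; rewrite lee_fin.
have pos (c : T -> R) t : 0 <= c^\+ t by exact: funrpos_ge0.
have neg (c : T -> R) t : 0 <= c^\- t by exact: funrneg_ge0.
have dec (c : T -> R) t : c t = c^\+ t - c^\- t by rewrite -[in LHS](funrposBneg c).
rewrite (@rsumE (fun t => a^\+ t + b^\+ t) (fun t => a^\- t + b^\- t)).
- by rewrite !eD// !fineD// /rsum; lra.
- by move=> t; rewrite addr_ge0.
- by move=> t; rewrite addr_ge0.
- by move=> t; rewrite (dec a t) (dec b t); lra.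
- by rewrite eD// fin_numD ap.
- by rewrite eD// fin_numD an.
Qed.

Lemma rsumZ c a : abs_summable a -> rsum (fun t => c * a t) = c * rsum a.
Proof.
move=> /abs_summable_fin[ap an].
have pos t : 0 <= a^\+ t by exact: funrpos_ge0.
have neg t : 0 <= a^\- t by exact: funrneg_ge0.
have dec t : a t = a^\+ t - a^\- t by rewrite -[in LHS](funrposBneg a).
have eZ d (x : T -> R) : 0 <= d -> (forall t, 0 <= x t) ->
    (\esum_(t in [set: T]) ((d * x t)%:E) =
     d%:E * \esum_(t in [set: T]) ((x t)%:E))%E.
  by move=> d0 x0; rewrite -ge0_esumZl// => t; rewrite lee_fin.
have [c0|c0] := leP 0 c.
  rewrite (@rsumE (fun t => c * a^\+ t) (fun t => c * a^\- t)).
  - by rewrite !eZ// !fineM// /rsum /=; ring.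
  - by move=> t; rewrite mulr_ge0.
  - by move=> t; rewrite mulr_ge0.
  - by move=> t; rewrite [in LHS]dec; ring.
  - by rewrite eZ// fin_numM.
  - by rewrite eZ// fin_numM.
(* A negative factor exchanges the roles of the two parts. *)
have c0' : 0 <= - c by rewrite oppr_ge0 ltW.
rewrite (@rsumE (fun t => (- c) * a^\- t) (fun t => (- c) * a^\+ t)).
- by rewrite !eZ// !fineM// /rsum /=; ring.
- by move=> t; rewrite mulr_ge0.
- by move=> t; rewrite mulr_ge0.
- by move=> t; rewrite [in LHS]dec; ring.
- by rewrite eZ// fin_numM.
- by rewrite eZ// fin_numM.
Qed.

Lemma ge0_rsum a : (forall t, 0 <= a t) ->
  rsum a = fine (\esum_(t in [set: T]) ((a t)%:E)).
Proof.
move=> a0; rewrite /rsum [X in _ - fine X]esum1 ?subr0 /=.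
  congr fine; apply: eq_esum => t _; congr EFin.
  by rewrite /funrpos; apply/max_idPl.
by move=> t _; congr EFin; rewrite /funrneg; apply/max_idPr; rewrite oppr_le0.
Qed.

Lemma abs_summable_le a b : (forall t, `|a t| <= b t) ->
  (\esum_(t in [set: T]) ((b t)%:E) < +oo)%E -> abs_summable a.
Proof.
by move=> ab; apply: le_lt_trans; apply: le_esum => t _; rewrite lee_fin.
Qed.

End UnconditionalSums.

(** * Complex sums and the inner product *)

Section ComplexSums.
Variable R : realType.
Implicit Types (z w : R[i]).

Lemma sqr_normcE z : normc z ^+ 2 = complex.Re z ^+ 2 + complex.Im z ^+ 2.
Proof. by case: z => x y /=; rewrite sqr_sqrtr// addr_ge0// sqr_ge0. Qed.

Lemma normc_ge0 z : 0 <= normc z.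
Proof. by case: z => x y; rewrite /= sqrtr_ge0. Qed.

Lemma normc_conjc z : normc (conjc z) = normc z.
Proof. by case: z => x y; rewrite /= sqrrN. Qed.

Lemma le_normc_Re z : `|complex.Re z| <= normc z.
Proof.
rewrite -(ler_sqr (normr_ge0 _)) ?nnegrE ?normc_ge0//.
by rewrite sqr_normcE real_normK ?num_real// lerDl sqr_ge0.
Qed.

Lemma le_normc_Im z : `|complex.Im z| <= normc z.
Proof.
rewrite -(ler_sqr (normr_ge0 _)) ?nnegrE ?normc_ge0//.
by rewrite sqr_normcE real_normK ?num_real// lerDr sqr_ge0.
Qed.

Lemma mul_conjc z : conjc z * z = (normc z ^+ 2)%:C%C.
Proof.
rewrite sqr_normcE; case: z => x y /=; rewrite /real_complex_def.
by apply/eqP; rewrite eq_complex /=; apply/andP; split; apply/eqP; ring.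
Qed.

Lemma normc_real (x : R) : normc x%:C%C = `|x|.
Proof. by rewrite /= expr0n addr0 sqrtr_sqr. Qed.

Lemma eq_complexP z w : complex.Re z = complex.Re w ->
  complex.Im z = complex.Im w -> z = w.
Proof. by case: z w => [a b] [c d] /= -> ->. Qed.

Variable T : choiceType.
Implicit Types (a b : T -> R[i]).

Definition csummable a := (\esum_(t in [set: T]) ((normc (a t))%:E) < +oo)%E.

Lemma csummable_Re a : csummable a -> abs_summable (fun t => complex.Re (a t)).
Proof. by apply: abs_summable_le => t; exact: le_normc_Re. Qed.

Lemma csummable_Im a : csummable a -> abs_summable (fun t => complex.Im (a t)).
Proof. by apply: abs_summable_le => t; exact: le_normc_Im. Qed.

Lemma csummable_le a (b : T -> R) : (forall t, normc (a t) <= b t) ->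
  (\esum_(t in [set: T]) ((b t)%:E) < +oo)%E -> csummable a.
Proof.
by move=> ab; apply: le_lt_trans; apply: le_esum => t _; rewrite lee_fin.
Qed.

Lemma csummableD a b : csummable a -> csummable b ->
  csummable (fun t => a t + b t).
Proof.
move=> sa sb; apply: (@csummable_le _ (fun t => normc (a t) + normc (b t))).
  by move=> t; exact: le_normcD.
rewrite (@eq_esum _ _ _ _ (fun t => (normc (a t))%:E + (normc (b t))%:E)%E)//.
by rewrite esumD ?lte_add_pinfty// => t _; rewrite lee_fin normc_ge0.
Qed.

Lemma csummableZ z a : csummable a -> csummable (fun t => z * a t).
Proof.
move=> sa; apply: (@csummable_le _ (fun t => normc z * normc (a t))).
  by move=> t; rewrite normcM.
under eq_esum do rewrite EFinM.
rewrite ge0_esumZl ?normc_ge0//; last by move=> t; rewrite lee_fin normc_ge0.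
by rewrite lte_mul_pinfty// ?lee_fin ?normc_ge0.
Qed.

Lemma csum0 : csum (fun _ : T => 0) = 0 :> R[i].
Proof.
by rewrite /csum ge0_rsum//= esum1.
Qed.

Lemma csumD a b : csummable a -> csummable b ->
  csum (fun t => a t + b t) = csum a + csum b.
Proof.
move=> sa sb; apply: eq_complexP.
  rewrite raddfD /= -rsumD; try exact: csummable_Re.
  by congr rsum; apply/funext => t; rewrite raddfD.
rewrite raddfD /= -rsumD; try exact: csummable_Im.
by congr rsum; apply/funext => t; rewrite raddfD.
Qed.

Lemma csumZ z a : csummable a -> csum (fun t => z * a t) = z * csum a.
Proof.
move=> sa; case: z => x y; rewrite /csum.
have [sr si] := (csummable_Re sa, csummable_Im sa).
have sZ c (d : T -> R) : abs_summable d -> abs_summable (fun t => c * d t).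
  move=> sd; apply: (@abs_summable_le _ _ _ (fun t => `|c| * `|d t|)).
    by move=> t; rewrite normrM.
  under eq_esum do rewrite EFinM.
  by rewrite ge0_esumZl// lte_mul_pinfty// lee_fin.
apply: eq_complexP => /=.
  rewrite -mulNr -!rsumZ// -rsumD; try exact: sZ.
  by congr rsum; apply/funext => t; case: (a t) => u v /=; ring.
rewrite -!rsumZ// -rsumD; try exact: sZ.
by congr rsum; apply/funext => t; case: (a t) => u v /=; ring.
Qed.

Lemma csummable0 : csummable (fun _ : T => 0).
Proof. by rewrite /csummable esum1 ?ltry// => t _; rewrite normc0. Qed.

Lemma csummable_sum (K : Type) (r : seq K) (c : K -> R[i]) (g : K -> T -> R[i]) :
  (forall k, csummable (g k)) ->
  csummable (fun t => \sum_(k <- r) c k * g k t).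
Proof.
move=> sg; elim: r => [|k r ih].
  by under eq_fun do rewrite big_nil; exact: csummable0.
under eq_fun do rewrite big_cons.
by apply: csummableD => //; exact: csummableZ.
Qed.

Lemma csum_sum (K : Type) (r : seq K) (c : K -> R[i]) (g : K -> T -> R[i]) :
  (forall k, csummable (g k)) ->
  csum (fun t => \sum_(k <- r) c k * g k t) = \sum_(k <- r) c k * csum (g k).
Proof.
move=> sg; elim: r => [|k r ih].
  by under eq_fun do rewrite big_nil; rewrite big_nil csum0.
under eq_fun do rewrite big_cons.
rewrite big_cons csumD ?ih ?csumZ//; first exact: csummableZ.
exact: csummable_sum.
Qed.

Lemma csum_conjc a : csummable a -> csum (fun t => conjc (a t)) = conjc (csum a).
Proof.
move=> sa; apply: eq_complexP => /=.
  by congr rsum; apply/funext => t; case: (a t).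
rewrite -mulN1r -rsumZ; last exact: csummable_Im.
by congr rsum; apply/funext => t; case: (a t) => x y /=; rewrite mulN1r.
Qed.

Lemma ge0_csum (p : T -> R) : (forall t, 0 <= p t) ->
  csum (fun t => (p t)%:C%C) = (fine (\esum_(t in [set: T]) ((p t)%:E)))%:C%C.
Proof.
move=> p0; apply: eq_complexP => /=; first by rewrite -ge0_rsum.
by rewrite ge0_rsum// esum1.
Qed.

End ComplexSums.

Section StringSpaceTheory.
Variable R : realType.
Implicit Types (phi psi : seq bool -> R[i]).

Lemma sqnorm_ge0 psi : (0 <= sqnorm psi)%E.
Proof. by apply: esum_ge0 => s _; rewrite lee_fin sqr_ge0. Qed.

Lemma string_space_fin psi : string_space psi -> sqnorm psi \is a fin_num.
Proof. by move=> h; rewrite ge0_fin_numE// sqnorm_ge0. Qed.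

(** Domination by |phi s|^2 + |psi s|^2, from the expanded square of |phi s| - |psi s|. *)
Lemma inner_csummable phi psi : string_space phi -> string_space psi ->
  csummable (fun s => conjc (phi s) * psi s).
Proof.
move=> sphi spsi.
apply: (@csummable_le _ _ _ (fun s => normc (phi s) ^+ 2 + normc (psi s) ^+ 2)).
  move=> s; rewrite normcM normc_conjc.
  have : 0 <= (normc (phi s) - normc (psi s)) ^+ 2 by exact: sqr_ge0.
  by have := mulr_ge0 (normc_ge0 (phi s)) (normc_ge0 (psi s)); nra.
rewrite (@eq_esum _ _ _ _
  (fun s => (normc (phi s) ^+ 2)%:E + (normc (psi s) ^+ 2)%:E)%E)//.
by rewrite esumD ?lte_add_pinfty// => s _; rewrite lee_fin sqr_ge0.
Qed.

Lemma string_spaceD phi psi : string_space phi -> string_space psi ->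
  string_space (fun s => phi s + psi s).
Proof.
move=> sphi spsi; rewrite /string_space /= /sqnorm.
apply: (@le_lt_trans _ _ (2%:E * sqnorm phi + 2%:E * sqnorm psi)%E); last first.
  by rewrite lte_add_pinfty// lte_mul_pinfty.
rewrite /sqnorm -!ge0_esumZl//; try by move=> s; rewrite lee_fin sqr_ge0.
rewrite -esumD; try by move=> s _; rewrite mule_ge0// lee_fin sqr_ge0.
apply: le_esum => s _; rewrite -!EFinM -EFinD lee_fin !sqr_normcE.
case: (phi s) (psi s) => [x y] [x' y'] /=.
by have := sqr_ge0 (x - x'); have := sqr_ge0 (y - y'); nra.
Qed.

Lemma sqnormZ z psi :
  sqnorm (fun s => z * psi s) = ((normc z ^+ 2)%:E * sqnorm psi)%E.
Proof.
rewrite /sqnorm -ge0_esumZl ?sqr_ge0//; last first.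
  by move=> s; rewrite lee_fin sqr_ge0.
by apply: eq_esum => s _; rewrite normcM exprMn EFinM.
Qed.

Lemma string_spaceZ z psi : string_space psi ->
  string_space (fun s => z * psi s).
Proof.
by rewrite /string_space /= sqnormZ => h; rewrite lte_mul_pinfty ?lee_fin ?sqr_ge0.
Qed.

Lemma string_space0 : string_space (fun=> 0 : R[i]).
Proof.
by rewrite /string_space/= /sqnorm esum1 ?ltry// => s _; rewrite normc0 expr0n.
Qed.

Lemma string_space_sum (K : Type) (r : seq K) (c : K -> R[i])
    (g : K -> seq bool -> R[i]) : (forall k, string_space (g k)) ->
  string_space (fun s => \sum_(k <- r) c k * g k s).
Proof.
move=> sg; elim: r => [|k r ih].
  by under eq_fun do rewrite big_nil; exact: string_space0.
under eq_fun do rewrite big_cons.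
by apply: string_spaceD => //; exact: string_spaceZ.
Qed.

Lemma inner_conj phi psi : string_space phi -> string_space psi ->
  inner psi phi = conjc (inner phi psi).
Proof.
move=> sphi spsi; rewrite /inner -csum_conjc; last exact: inner_csummable.
by congr csum; apply/funext => s; rewrite rmorphM /= conjcK mulrC.
Qed.

Lemma inner_sumr (K : Type) (r : seq K) (c : K -> R[i])
    (g : K -> seq bool -> R[i]) phi :
  string_space phi -> (forall k, string_space (g k)) ->
  inner phi (fun s => \sum_(k <- r) c k * g k s)
    = \sum_(k <- r) c k * inner phi (g k).
Proof.
move=> sphi sg; rewrite /inner -csum_sum => [|k]; last exact: inner_csummable.
congr csum; apply/funext => s; rewrite mulr_sumr; apply: eq_bigr => k _.
by rewrite mulrCA.
Qed.

Lemma inner_self psi : inner psi psi = (fine (sqnorm psi))%:C%C.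
Proof.
rewrite /inner -ge0_csum; first by congr csum; apply/funext => s; exact: mul_conjc.
by move=> s; exact: sqr_ge0.
Qed.

(** Pythagoras: for the combination v, orthonormality gives <g_k|v> = c_k, and expanding the right
    argument of <v|v> leaves the sum of the c_k^* c_k. *)
Lemma sqnorm_orthonormal_sum (K : choiceType) (g : K -> seq bool -> R[i])
    (r : seq K) (c : K -> R[i]) : orthonormal_system g -> uniq r ->
  sqnorm (fun s => \sum_(k <- r) c k * g k s)
    = (\sum_(k <- r) normc (c k) ^+ 2)%:E.
Proof.
move=> [sg og] ur; set v := fun s => _.
have sv : string_space v by exact: string_space_sum.
have gv k : k \in r -> inner (g k) v = c k.
  move=> kr; rewrite inner_sumr// (bigD1_seq k)//= og eqxx mulr1.
  by rewrite big1 ?addr0// => l lk; rewrite og eq_sym (negbTE lk) mulr0.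
have vv : inner v v = (\sum_(k <- r) normc (c k) ^+ 2)%:C%C.
  rewrite {2}/v inner_sumr// raddf_sum /=; apply: eq_big_seq => k kr.
  by rewrite (inner_conj (sg k) sv) gv// mulrC mul_conjc.
rewrite -(fineK (string_space_fin sv)); congr EFin.
by move: vv; rewrite inner_self => -[].
Qed.

End StringSpaceTheory.

(** * Bessel's inequality and independence of the basis *)

Section Coordinates.
Variable R : realType.
Implicit Types (phi psi : seq bool -> R[i]) (u : seq bool).

Lemma sum_mul_sqr_le (K : Type) (r : seq K) (a b : K -> R) :
  (\sum_(k <- r) a k * b k) ^+ 2
    <= (\sum_(k <- r) a k ^+ 2) * (\sum_(k <- r) b k ^+ 2).
Proof.
elim: r => [|k r ih]; first by rewrite !big_nil expr0n mul0r.
rewrite !big_cons; move: ih.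
have : 0 <= \sum_(j <- r) a j ^+ 2 by apply: sumr_ge0 => j _; exact: sqr_ge0.
have : 0 <= \sum_(j <- r) b j ^+ 2 by apply: sumr_ge0 => j _; exact: sqr_ge0.
move: (\sum_(j <- r) a j ^+ 2) (\sum_(j <- r) b j ^+ 2) (\sum_(j <- r) a j * b j).
move=> A B C B0 A0 CAB; move: (a k) (b k) => x y.
(* The cross terms of the induction step for Cauchy-Schwarz. Squared, the claim follows from C^2 <=
   AB and 4AB(xy)^2 <= (Ay^2 + Bx^2)^2. *)
suff : 2 * C * (x * y) <= A * y ^+ 2 + B * x ^+ 2 by nra.
apply: (le_trans (ler_norm _)).
have Ay : 0 <= A * y ^+ 2 by rewrite mulr_ge0 ?sqr_ge0.
have Bx : 0 <= B * x ^+ 2 by rewrite mulr_ge0 ?sqr_ge0.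
rewrite -(ler_sqr (normr_ge0 _)) ?nnegrE ?addr_ge0// real_normK ?num_real//.
have := ler_wpM2r (sqr_ge0 (x * y)) CAB.
by have := sqr_ge0 (A * y ^+ 2 - B * x ^+ 2); nra.
Qed.

Lemma normc_sum_mul_le (K : Type) (r : seq K) (a b : K -> R[i]) :
  normc (\sum_(k <- r) a k * b k) ^+ 2
    <= (\sum_(k <- r) normc (a k) ^+ 2) * (\sum_(k <- r) normc (b k) ^+ 2).
Proof.
apply: (le_trans _ (sum_mul_sqr_le r (fun k => normc (a k)) (fun k => normc (b k)))).
rewrite ler_sqr ?nnegrE ?normc_ge0//; last first.
  by apply: sumr_ge0 => k _; rewrite mulr_ge0 ?normc_ge0.
elim: r => [|k r ih]; first by rewrite !big_nil normc0.
rewrite !big_cons; apply: le_trans (le_normcD _ _) _.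
by rewrite normcM lerD2l.
Qed.

(** Young's inequality with a free weight: for small [t] the factor of the main term z tends to 1,
    and the large factor 1 + 1/t falls on an error w that can be chosen smaller still. *)
Lemma sqr_normcD_le (t : R) (z w : R[i]) : 0 < t ->
  normc (z + w) ^+ 2 <= (1 + t) * normc z ^+ 2 + (1 + t^-1) * normc w ^+ 2.
Proof.
move=> t0; rewrite !sqr_normcE; case: z w => [x y] [x' y'] /=.
have young (p q : R) : (p + q) ^+ 2 <= (1 + t) * p ^+ 2 + (1 + t^-1) * q ^+ 2.
  have -> : (1 + t) * p ^+ 2 + (1 + t^-1) * q ^+ 2
    = (p + q) ^+ 2 + t^-1 * (t * p - q) ^+ 2 by field; rewrite gt_eqF.
  by rewrite lerDl mulr_ge0 ?sqr_ge0// invr_ge0 ltW.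
by have := young x x'; have := young y y'; lra.
Qed.

Lemma sqnormD_le (t : R) phi psi : 0 < t ->
  (sqnorm (fun s => (phi s + psi s)%R)
    <= (1 + t)%:E * sqnorm phi + (1 + t^-1)%:E * sqnorm psi)%E.
Proof.
move=> t0; have t1 : 0 <= 1 + t by lra.
have t2 : 0 <= 1 + t^-1 by rewrite addr_ge0// invr_ge0 ltW.
rewrite /sqnorm -!ge0_esumZl//; try by move=> s; rewrite lee_fin sqr_ge0.
rewrite -esumD; try by move=> s _; rewrite mule_ge0// lee_fin sqr_ge0.
apply: le_esum => s _; rewrite -!EFinM -EFinD lee_fin.
exact: sqr_normcD_le.
Qed.

Lemma coord_le_sqnorm psi u : ((normc (psi u) ^+ 2)%:E <= sqnorm psi)%E.
Proof. exact: (le_esum1 (fun s => (normc (psi s) ^+ 2)%:E)). Qed.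

Lemma conj_coord_sum (K : choiceType) (g : K -> seq bool -> R[i]) (r : seq K) u :
  \sum_(k <- r) conjc (g k u) * g k u = (\sum_(k <- r) normc (g k u) ^+ 2)%:C%C.
Proof. by rewrite raddf_sum; apply: eq_bigr => k _; exact: mul_conjc. Qed.

(* The vector v = \sum_k (g_k u)^* g_k, over finitely many k, satisfies
   v u = |v|^2, while |v u| <= |v|. *)
Lemma bessel_coord (K : choiceType) (g : K -> seq bool -> R[i]) u :
  orthonormal_system g ->
  (\esum_(k in [set: K]) (normc (g k u) ^+ 2)%:E <= 1)%E.
Proof.
move=> og; apply: esum_le_seq => r ur; rewrite sumEFin lee_fin.
have := coord_le_sqnorm (fun s => \sum_(k <- r) conjc (g k u) * g k s) u.
rewrite sqnorm_orthonormal_sum// conj_coord_sum normc_real lee_fin.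
under [X in _ <= X]eq_bigr do rewrite normc_conjc.
set B := \sum_(k <- r) _; rewrite real_normK ?num_real//.
have : 0 <= B by apply: sumr_ge0 => k _; exact: sqr_ge0.
by have [//|B1] := leP B 1; nra.
Qed.

(** The list in [lin_span] may repeat indices, whereas Pythagoras needs distinct ones; repetitions
    are absorbed into the coefficients as multiplicities. *)
Lemma lin_span_uniq (K : choiceType) (g : K -> seq bool -> R[i]) v :
  lin_span g v -> exists r : seq K, exists c : K -> R[i],
    uniq r /\ v = fun s => \sum_(k <- r) c k * g k s.
Proof.
move=> [r [c ->]]; exists (undup r), (fun k => c k *+ count_mem k r).
split; first exact: undup_uniq.
apply/funext => s; rewrite -big_undup_iterop_count; apply: eq_bigr => k _.
by rewrite Monoid.iteropE mulrnAl; elim: (count _ _) => //= n ->; rewrite mulrS.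
Qed.

Lemma lin_span_closed_span (K : choiceType) (g : K -> seq bool -> R[i]) v :
  orthonormal_system g -> lin_span g v -> closed_span g v.
Proof.
move=> [sg _] gv; split; first by case: gv => r [c ->]; exact: string_space_sum.
move=> eps eps0; exists v => //; rewrite /sqnorm esum1 ?lte_fin// => s _.
by rewrite subrr normc0 expr0n.
Qed.

(** Cauchy-Schwarz on the finite expansion of v, whose coefficients have square sum |v|^2. The bound
    no longer mentions the expansion, so it can be used on approximants. *)
Lemma coord_lin_span_le (K : choiceType) (g : K -> seq bool -> R[i]) v u :
  orthonormal_system g -> lin_span g v ->
  ((normc (v u) ^+ 2)%:E
    <= sqnorm v * \esum_(k in [set: K]) (normc (g k u) ^+ 2)%:E)%E.
Proof.
move=> og /lin_span_uniq[r [c [ur ->]]]; rewrite sqnorm_orthonormal_sum//.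
apply: (@le_trans _ _ ((\sum_(k <- r) normc (c k) ^+ 2)%:E *
                       (\sum_(k <- r) normc (g k u) ^+ 2)%:E)%E).
  by rewrite -EFinM lee_fin; exact: normc_sum_mul_le.
rewrite lee_wpmul2l//.
  by rewrite lee_fin; apply: sumr_ge0 => k _; exact: sqr_ge0.
by rewrite -sumEFin; exact: seq_le_esum.
Qed.

(* Both sides are |P|u>|^2 for the projector P onto the closed span, once the
   inclusion is an equality.  The vector v below is the projection of |u> onto
   the span of finitely many e_i, so that v u = |v|^2; it is approximated by
   finite combinations of the f_j, to which Cauchy-Schwarz applies. *)
Lemma coord_sum_le (I J : choiceType) (e : I -> seq bool -> R[i])
    (f : J -> seq bool -> R[i]) u :
  orthonormal_system e -> orthonormal_system f ->
  closed_span e `<=` closed_span f ->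
  (\esum_(i in [set: I]) (normc (e i u) ^+ 2)%:E
    <= \esum_(j in [set: J]) (normc (f j u) ^+ 2)%:E)%E.
Proof.
move=> oe of_ ef; apply: esum_le_seq => r ur; rewrite sumEFin.
have f0 j : (0 <= (normc (f j u) ^+ 2)%:E)%E by rewrite lee_fin sqr_ge0.
have Ffin := esum_fin_num f0 (bessel_coord u of_).
have := esum_ge0 (fun j (_ : [set: J] j) => f0 j).
have := @coord_lin_span_le _ f _ u of_.
rewrite -(fineK Ffin) !lee_fin; move: (fine _) => F CS F0.
set B := \sum_(k <- r) _.
have B0 : 0 <= B by apply: sumr_ge0 => k _; exact: sqr_ge0.
pose v s := \sum_(k <- r) conjc (e k u) * e k s.
have vu : v u = B%:C%C by exact: conj_coord_sum.
have nv : sqnorm v = B%:E.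
  by rewrite sqnorm_orthonormal_sum//; under eq_bigr do rewrite normc_conjc.
have [_ fv] : closed_span f v.
  by apply/ef/lin_span_closed_span => //; exists r, (fun k => conjc (e k u)).
(* The approximant w is taken with |v - w|^2 < t^2, so that the error weighted by 1 + 1/t is at most
   t^2 + t <= 2t. Then |w|^2 <= (1 + t)B + 2t and B^2 <= (1 + t)((1 + t)B + 2t)F + 2t; expanding
   with t^2 <= t gives the constants 3, 4 and 2. *)
have key t : 0 < t -> t <= 1 ->
    B ^+ 2 <= B * F + t * (3 * (B * F) + 4 * F + 2).
  move=> t0 t1; have [w fw dw] := fv (t ^+ 2) (exprn_gt0 2 t0).
  have fin_d : sqnorm (fun s => v s - w s) \is a fin_num.
    by rewrite ge0_fin_numE ?sqnorm_ge0//; exact: lt_trans dw (ltry _).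
  have wE : w = fun s => v s + (-1) * (v s - w s) by apply/funext => s; ring.
  have vE : v u = w u + (v u - w u) by ring.
  have := coord_le_sqnorm (fun s => v s - w s) u.
  have := sqnormD_le v (fun s => (-1) * (v s - w s)) t0.
  rewrite -wE nv sqnormZ normcN normc1 expr1n mul1e => w1.
  have fin_w : sqnorm w \is a fin_num.
    rewrite ge0_fin_numE ?sqnorm_ge0//; apply: le_lt_trans w1 _.
    by rewrite -(fineK fin_d) -!EFinM -EFinD ltry.
  have := CS _ fw; move: w1 dw (sqnorm_ge0 w) (sqr_normcD_le (w u) (v u - w u) t0).
  rewrite -vE vu normc_real real_normK ?num_real//.
  rewrite -(fineK fin_d) -(fineK fin_w).
  rewrite -!EFinM -EFinD !lee_fin !lte_fin.
  move: (fine (sqnorm w)) => W; move: (fine (sqnorm _)) => D.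
  move: (normc (w u) ^+ 2) => x; move: (normc _ ^+ 2) => y.
  move=> W1 D1 W0 young xF yD.
  have ti : (1 + t^-1) * t ^+ 2 = t ^+ 2 + t by field; rewrite gt_eqF.
  have t2 : 0 < 1 + t^-1 by rewrite addr_gt0// invr_gt0.
  have h1 : (1 + t^-1) * D <= t ^+ 2 + t by rewrite -ti ler_pM2l// ltW.
  have h2 : (1 + t^-1) * y <= t ^+ 2 + t.
    by apply: le_trans h1; rewrite ler_pM2l.
  have tt : t ^+ 2 <= t by rewrite expr2 ger_pMr.
  have h3 : W <= (1 + t) * B + 2 * t by lra.
  have h4 : x <= ((1 + t) * B + 2 * t) * F by exact: le_trans xF (ler_wpM2r F0 h3).
  have h5 : (1 + t) * x <= (1 + t) * (((1 + t) * B + 2 * t) * F).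
    by rewrite ler_pM2l//; lra.
  have BF0 : 0 <= B * F by exact: mulr_ge0.
  have h6 : t ^+ 2 * (B * F) <= t * (B * F) by exact: ler_wpM2r.
  have h7 : t ^+ 2 * F <= t * F by exact: ler_wpM2r.
  by nra.
have BBF : B ^+ 2 <= B * F.
  apply/ler_addgt0Pr => eps eps0.
  set C := 3 * (B * F) + 4 * F + 2 in key.
  have C0 : 0 < C by have := mulr_ge0 B0 F0; rewrite /C; lra.
  have t0 : 0 < Num.min 1 (eps / C) by rewrite lt_min ltr01 divr_gt0.
  apply: le_trans (key _ t0 _) _; first by rewrite ge_min lexx.
  by rewrite lerD2l -ler_pdivlMr// ge_min lexx orbT.
have [->//|Bp] := eqVneq B 0.
by rewrite -(ler_pM2l (_ : 0 < B)) ?lt_def ?Bp// -expr2.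
Qed.

Lemma coord_sum_eq (I J : choiceType) (e : I -> seq bool -> R[i])
    (f : J -> seq bool -> R[i]) u :
  orthonormal_system e -> orthonormal_system f -> closed_span e = closed_span f ->
  (\esum_(i in [set: I]) (normc (e i u) ^+ 2)%:E
    = \esum_(j in [set: J]) (normc (f j u) ^+ 2)%:E)%E.
Proof. by move=> oe of_ ef; apply/le_anti; rewrite !coord_sum_le// ef. Qed.

End Coordinates.

(** * Concatenation and Kraft's inequality *)

Lemma catIr (T : Type) (s t t' : seq T) : t ++ s = t' ++ s -> t = t'.
Proof.
move/(congr1 (fun u => take (size u - size s) u)).
by rewrite !size_cat !addnK !take_size_cat.
Qed.

(** Reversal turns suffixes into prefixes, and the shorter of two prefixes of one string is a
    truncation of the longer. *)
Lemma suffix_comparable (T : eqType) (s s' u : seq T) :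
  suffix s u -> suffix s' u -> (size s <= size s')%N -> suffix s s'.
Proof.
rewrite -!prefix_rev -(size_rev s) -(size_rev s').
by rewrite !prefixE => /eqP eqs /eqP eqs' ss; rewrite -eqs' take_takel// eqs.
Qed.

Section Concatenation.
Variable R : realType.
Implicit Types (phi psi : seq bool -> R[i]) (s t u : seq bool).

Lemma concat_cat psi t s : concat psi s (t ++ s) = psi t.
Proof. by rewrite /concat suffix_suffix size_cat addnK take_size_cat. Qed.

Lemma concat_cat2 psi t r s : concat psi (r ++ s) (t ++ s) = concat psi r t.
Proof.
rewrite /concat suffix_catl// eqxx /= !size_cat subnDr.
by case: ifP => // _; rewrite takel_cat// leq_subr.
Qed.

Lemma concat_nil psi : concat psi [::] = psi.
Proof. by apply/funext => u; rewrite -[u in LHS]cats0 concat_cat. Qed.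

Lemma concat_notin psi s u : ~~ suffix s u -> concat psi s u = 0.
Proof. by rewrite /concat => /negbTE ->. Qed.

(** Appending s is a bijection from all strings onto those ending in s. Through it, shifting by s
    preserves norms and inner products. *)
Lemma esum_suffix s (a : seq bool -> \bar R) :
  (forall u, ~~ suffix s u -> a u = 0%E) ->
  \esum_(u in [set: seq bool]) a u = \esum_(t in [set: seq bool]) a (t ++ s).
Proof.
move=> a0; rewrite -(@reindex_esum _ _ _ _ [set u | suffix s u] (cat^~ s)).
  rewrite [RHS]esum_mkcond; apply: eq_esum => u _; case: ifPn => // su.
  by apply: a0; apply: contra su => su; rewrite inE.
split.
- by move=> t _ /=; exact: suffix_suffix.
- by move=> t t' _ _ /catIr.
- by move=> u /suffixP[t ->]; exists t.
Qed.

Lemma rsum_suffix s (a : seq bool -> R) : (forall u, ~~ suffix s u -> a u = 0) ->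
  rsum a = rsum (fun t => a (t ++ s)).
Proof.
move=> a0; rewrite /rsum (esum_suffix (s := s)); last first.
  by move=> u su; rewrite /funrpos a0// maxxx.
congr (_ - fine _); apply: esum_suffix => u su.
by rewrite /funrneg a0// oppr0 maxxx.
Qed.

Lemma csum_suffix s (a : seq bool -> R[i]) : (forall u, ~~ suffix s u -> a u = 0) ->
  csum a = csum (fun t => a (t ++ s)).
Proof.
move=> a0; rewrite /csum (rsum_suffix (s := s)); last by move=> u su; rewrite a0.
by rewrite [X in Complex _ X](rsum_suffix (s := s))// => u su; rewrite a0.
Qed.

Lemma sqnorm_concat psi s : sqnorm (concat psi s) = sqnorm psi.
Proof.
rewrite /sqnorm (esum_suffix (s := s)).
  by apply: eq_esum => t _; rewrite concat_cat.
by move=> u su; rewrite concat_notin// normc0 expr0n.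
Qed.

Lemma inner_concat phi psi r s :
  inner (concat phi s) (concat psi (r ++ s)) = inner phi (concat psi r).
Proof.
rewrite /inner (csum_suffix (s := s)).
  by congr csum; apply/funext => t; rewrite concat_cat concat_cat2.
by move=> u su; rewrite concat_notin// conjc0 mul0r.
Qed.

(** If one shift is a suffix of the other, the common suffix cancels, leaving <e_k|e_l o r>:
    orthonormality settles empty r, prefix-freeness nonempty r. If neither is a suffix of the other,
    no string ends in both and the supports are disjoint. *)
Lemma concat_orthonormal (I : choiceType) (e : I -> seq bool -> R[i]) :
  orthonormal_system e -> prefix_free (range e) ->
  orthonormal_system (fun k : I * seq bool => concat (e k.1) k.2).
Proof.
move=> [se oe] pf; have sc i s : string_space (concat (e i) s).
  by rewrite /string_space /= sqnorm_concat; exact: se.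
split => [[i s]|[i s] [j s'] /=]; first exact: sc.
have cmp k l t t' : suffix t t' ->
    inner (concat (e k) t) (concat (e l) t') = ((k, t) == (l, t'))%:R.
  move=> /suffixP[r ->]; rewrite inner_concat xpair_eqE.
  have [->|r0] := eqVneq r [::]; first by rewrite concat_nil oe eqxx andbT.
  rewrite (pf (e k) (e l)); [|by exists k|by exists l|exact/eqP].
  rewrite (_ : t == r ++ t = false) ?andbF//; apply: contraNF r0 => /eqP tr.
  by apply/eqP/esym/(@catIr _ t).
have [/cmp->//|ns] := boolP (suffix s s').
have [/cmp sc'|ns'] := boolP (suffix s' s).
  by rewrite (inner_conj (sc j s') (sc i s)) sc' conjc_nat eq_sym.
rewrite xpair_eqE (_ : s == s' = false) ?andbF; last first.
  by apply: contraNF ns => /eqP ->; exact: suffix_refl.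
transitivity (csum (fun _ : seq bool => 0 : R[i])); last exact: csum0.
rewrite /inner; congr csum; apply/funext => u.
have [su|su] := boolP (suffix s u); last first.
  by rewrite concat_notin// conjc0 mul0r.
rewrite [X in _ * X]concat_notin ?mulr0//.
apply: contra ns => su'; have [ss'|/ltnW ss'] := leqP (size s) (size s').
  exact: suffix_comparable su su' ss'.
by case/negP: ns'; exact: suffix_comparable su' su ss'.
Qed.

(** * Counting extensions and the Kraft bound *)

Fixpoint strings (n : nat) : seq (seq bool) :=
  if n is n'.+1 then map (cons true) (strings n') ++ map (cons false) (strings n')
  else [:: [::]].

Lemma size_strings n : size (strings n) = (2 ^ n)%N.
Proof. by elim: n => //= n ih; rewrite size_cat !size_map ih expnS mul2n addnn. Qed.

Lemma count_prefix_strings t n : (size t <= n)%N ->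
  count (prefix t) (strings n) = (2 ^ (n - size t))%N.
Proof.
elim: t n => [|b t ih] [|n] //=.
  by rewrite count_cat !count_map !count_predT size_strings addnn -mul2n -expnS.
rewrite ltnS subSS => tn.
(* Only the half of the list whose strings begin with the letter b contributes. *)
have cE c : count (preim (cons c) (prefix (b :: t))) (strings n)
    = ((c == b) * count (prefix t) (strings n))%N.
  have [->|cb] := eqVneq c b; rewrite ?mul1n ?mul0n.
    by apply: eq_count => u /=; rewrite eqxx.
  apply/eqP; rewrite -leqn0 leqNgt -has_count; apply/hasPn => u _ /=.
  by rewrite eq_sym (negbTE cb).
by rewrite count_cat !count_map !cE ih//; case: b {cE}; rewrite mul1n mul0n ?addn0.
Qed.

(* Each pair (i, t) with |t| <= n is charged to the 2^(n - |t|) strings u of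
   length n extending t: there |(e_i o s) u|^2 = |e_i t|^2 for u = t s, and
   Bessel's inequality for the orthonormal family e_i o s bounds the charges at
   every u by 1. *)
Lemma kraft_seq (I : choiceType) (e : I -> seq bool -> R[i])
    (r : seq (I * seq bool)) :
  orthonormal_system e -> prefix_free (range e) -> uniq r ->
  \sum_(k <- r) 2 ^- size k.2 * normc (e k.1 k.2) ^+ 2 <= 1.
Proof.
move=> oe pf ur; pose n := \max_(k <- r) size k.2.
have rn k : k \in r -> (size k.2 <= n)%N by move=> kr; exact: leq_bigmax_seq.
rewrite -(ler_pM2l (_ : 0 < 2 ^+ n :> R)) ?exprn_gt0// mulr1 mulr_sumr.
apply: (@le_trans _ _ (\sum_(u <- strings n) \sum_(k <- r | prefix k.2 u)
   normc (concat (e k.1) (drop (size k.2) u) u) ^+ 2)).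
  (* After exchanging the sums, the pair k is counted once for each of the 2^(n - |k.2|) strings
     extending k.2. *)
  under [leRHS]eq_bigr do rewrite big_mkcond.
  rewrite exchange_big /= big_seq [leRHS]big_seq.
  apply: ler_sum => k /rn kn; rewrite -big_mkcond /= mulrA.
  rewrite (eq_bigr (fun=> normc (e k.1 k.2) ^+ 2)).
    rewrite big_const_seq count_prefix_strings// iter_addr_0 -[leRHS]mulr_natl natrX.
    by rewrite -[in leLHS](subnK kn) exprD mulfK// expf_neq0.
  by move=> u /prefixP[s ->]; rewrite drop_size_cat// concat_cat.
apply: (@le_trans _ _ (\sum_(u <- strings n) 1)); last first.
  by rewrite big_const_seq count_predT size_strings iter_addr_0 natrX.
apply: ler_sum => u _; rewrite -big_filter.
(* For fixed u the remainder s in u = t s determines t, so h is injective on the pairs charged to u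
   and Bessel applies to distinct members of the family e_i o s. *)
pose h (k : I * seq bool) := (k.1, drop (size k.2) u).
rewrite -(big_map h xpredT (fun k => normc (concat (e k.1) k.2 u) ^+ 2)).
rewrite -lee_fin -sumEFin; apply: le_trans (bessel_coord u (concat_orthonormal oe pf)).
apply: seq_le_esum; rewrite map_inj_in_uniq ?filter_uniq//.
move=> [i t] [j t']; rewrite !mem_filter /= => /andP[/prefixP[s us] _].
move=> /andP[/prefixP[s' us'] _] [-> ]; rewrite {1}us us' !drop_size_cat// => ss'.
by congr pair; apply: (@catIr _ s); rewrite -us us' ss'.
Qed.

(** The double sum is a sum over pairs, hence a supremum of finite sums; each of these has its own n
    in [kraft_seq], which takes the place of a limit in n. *)
Lemma kraft (I : choiceType) (e : I -> seq bool -> R[i]) :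
  orthonormal_system e -> prefix_free (range e) ->
  (\esum_(i in [set: I]) \esum_(t in [set: seq bool])
     (2 ^- size t * normc (e i t) ^+ 2)%:E <= 1)%E.
Proof.
move=> oe pf; have ge0 k : (0 <= (2 ^- size k.2 * normc (e k.1 k.2) ^+ 2)%:E)%E.
  by rewrite lee_fin mulr_ge0 ?sqr_ge0// invr_ge0 exprn_ge0.
rewrite esum_esum//; last by move=> i t _ _; exact: ge0 (i, t).
have -> : [set: I] `*`` (fun=> [set: seq bool]) = [set: I * seq bool].
  by apply/seteqP; split.
by apply: esum_le_seq => r ur; rewrite sumEFin lee_fin; exact: kraft_seq.
Qed.

End Concatenation.

(** * Average and base lengths *)

Section Lengths.
Variable R : realType.
Implicit Types (phi : seq bool -> R[i]) (u : seq bool).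

(** The expectation <phi|2^(-Lambda)|phi>, kept as an extended nonnegative sum so that sums over
    vectors and over strings can be exchanged. *)
Definition pow2NLambda_mean phi : \bar R :=
  \esum_(u in [set: seq bool]) (2 ^- size u * normc (phi u) ^+ 2)%:E.

Lemma pow2NLambda_term_ge0 phi u : 0 <= 2 ^- size u * normc (phi u) ^+ 2.
Proof. by rewrite mulr_ge0 ?sqr_ge0// invr_ge0 exprn_ge0. Qed.

Lemma pow2NLambda_mean_ge0 phi : (0 <= pow2NLambda_mean phi)%E.
Proof. by apply: esum_ge0 => u _; rewrite lee_fin pow2NLambda_term_ge0. Qed.

Lemma pow2NLambda_mean_le phi : (pow2NLambda_mean phi <= sqnorm phi)%E.
Proof.
apply: le_esum => u _; rewrite lee_fin ler_piMl ?sqr_ge0//.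
by rewrite invf_le1 ?exprn_gt0// exprn_ege1// ler1n.
Qed.

Lemma Re_inner_pow2NLambda phi : string_space phi ->
  ((complex.Re (inner phi (pow2NLambda phi)))%:E = pow2NLambda_mean phi)%E.
Proof.
move=> sphi; have -> : inner phi (pow2NLambda phi)
    = csum (fun u => (2 ^- size u * normc (phi u) ^+ 2)%:C%C).
  congr csum; apply/funext => u; rewrite /pow2NLambda mulrCA mul_conjc.
  have -> : 2 ^- size u = (2 ^- size u : R)%:C%C :> R[i].
    by rewrite (fmorphV (real_complex R)) rmorphXn rmorph_nat.
  by rewrite -(rmorphM (real_complex R)).
rewrite ge0_csum /=; last exact: pow2NLambda_term_ge0.
rewrite fineK// ge0_fin_numE ?pow2NLambda_mean_ge0//.
exact: le_lt_trans (pow2NLambda_mean_le _) sphi.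
Qed.

Lemma sqnorm_inner1 phi : string_space phi -> inner phi phi = 1 -> sqnorm phi = 1%E.
Proof.
move=> sphi; rewrite inner_self => -[n1].
by rewrite -(fineK (string_space_fin sphi)) n1.
Qed.

Lemma unit_support phi : sqnorm phi = 1%E -> exists u, phi u != 0.
Proof.
move=> n1; apply: contrapT => h; have := n1; rewrite /sqnorm esum1.
  by move=> -[] /eqP; rewrite eq_sym oner_eq0.
move=> u _; have [->|pu] := eqVneq (phi u) 0; first by rewrite normc0 expr0n.
by case: h; exists u.
Qed.

(** * Jensen's inequality for the length distribution *)

Lemma powR_natN (n : nat) : 2 `^ (- n%:R) = 2 ^- n :> R.
Proof. by rewrite powRN powR_mulrn. Qed.

(** Convexity as a tangent line: after factoring out 2^(-m) this is 1 + y <= exp y at y = ln 2 (m -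
    x), strict for y != 0. *)
Lemma pow2_tangent (m x : R) :
  2 `^ (- m) * (1 + ln 2 * (m - x)) <= 2 `^ (- x) ?= iff (x == m).
Proof.
have pE y : 2 `^ y = expR (y * ln 2) :> R by rewrite /powR pnatr_eq0.
have l2 : 0 < ln 2 :> R by rewrite ln_gt0// ltr1n.
have -> : 2 `^ (- x) = 2 `^ (- m) * expR (ln 2 * (m - x)).
  by rewrite !pE -expRD; congr expR; ring.
split; first by rewrite ler_pM2l ?powR_gt0// expR_ge1Dx.
have p0 : 2 `^ (- m) != 0 :> R by rewrite gt_eqF// powR_gt0.
rewrite (inj_eq (mulfI p0)).
have [->|xm] := eqVneq x m; first by rewrite subrr mulr0 addr0 expR0 eqxx.
by rewrite lt_eqF// expR_gt1Dx// mulf_eq0 (gt_eqF l2) subr_eq0 eq_sym.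
Qed.

(* Defect at u of the tangent line to x |-> 2^(-x) at x = m, weighted by
   |phi u|^2: summed over u, the linear terms cancel when m is the average
   length. *)
Definition jensen_gap phi (m : R) u : R :=
  normc (phi u) ^+ 2 *
  (2 ^- size u - 2 `^ (- m) * (1 + ln 2 * (m - (size u)%:R))).

Lemma jensen_gap_ge0 phi m u : 0 <= jensen_gap phi m u.
Proof.
by rewrite mulr_ge0 ?sqr_ge0// subr_ge0 -powR_natN pow2_tangent.
Qed.

Lemma jensen_gap_eq0 phi m u : jensen_gap phi m u = 0 -> phi u != 0 ->
  (size u)%:R = m.
Proof.
move=> /eqP + pu; rewrite mulf_eq0 sqrf_eq0 => /predU1P[/eq0_normc/eqP|].
  by rewrite (negbTE pu).
by rewrite subr_eq0 -powR_natN eq_sym pow2_tangent => /eqP.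
Qed.

(** Jensen's inequality with its exact defect: nonnegativity of the gaps gives the bound, and their
    vanishing gives the equality case. *)
Lemma pow2NLambda_meanE phi (m : R) : sqnorm phi = 1%E -> avg_length phi = m%:E ->
  (pow2NLambda_mean phi
   = (2 `^ (- m))%:E + \esum_(u in [set: seq bool]) (jensen_gap phi m u)%:E)%E.
Proof.
move=> n1 am; have l2 : 0 < ln 2 :> R by rewrite ln_gt0// ltr1n.
have m0 : 0 <= m.
  by rewrite -lee_fin -am esum_ge0// => u _; rewrite lee_fin mulr_ge0 ?sqr_ge0.
have p0 : 0 < 2 `^ (- m) :> R by rewrite powR_gt0.
(* The negative linear term of the gap is moved to the left, so that only sums of nonnegative
   families occur. *)
have sum_eq : (pow2NLambda_mean phi + (2 `^ (- m) * ln 2)%:E * avg_length phi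
   = \esum_(u in [set: seq bool]) (jensen_gap phi m u)%:E
     + (2 `^ (- m) * (1 + ln 2 * m))%:E * sqnorm phi)%E.
  have c1 : 0 <= 2 `^ (- m) * ln 2 by rewrite mulr_ge0// ltW.
  have c2 : 0 <= 2 `^ (- m) * (1 + ln 2 * m).
    by rewrite mulr_ge0 ?powR_ge0// addr_ge0// mulr_ge0// ltW.
  rewrite /avg_length /sqnorm -!ge0_esumZl//; last 2 first.
  - by move=> u; rewrite lee_fin sqr_ge0.
  - by move=> u; rewrite lee_fin mulr_ge0 ?sqr_ge0.
  rewrite -!esumD; last 4 first.
  - by move=> u _; rewrite lee_fin jensen_gap_ge0.
  - by move=> u _; rewrite -EFinM lee_fin (mulr_ge0 c2)// sqr_ge0.
  - by move=> u _; rewrite lee_fin pow2NLambda_term_ge0.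
  - by move=> u _; rewrite -EFinM lee_fin (mulr_ge0 c1)// mulr_ge0 ?sqr_ge0.
  apply: eq_esum => u _; rewrite -!EFinM -!EFinD; congr EFin.
  by rewrite /jensen_gap; ring.
move: sum_eq; rewrite am n1 mule1 -EFinM.
have : pow2NLambda_mean phi \is a fin_num.
  rewrite ge0_fin_numE ?pow2NLambda_mean_ge0//.
  by apply: le_lt_trans (pow2NLambda_mean_le _) _; rewrite n1 ltry.
move=> /fineK <-; move: (fine _) => W.
have : (0 <= \esum_(u in [set: seq bool]) (jensen_gap phi m u)%:E)%E.
  by apply: esum_ge0 => u _; rewrite lee_fin jensen_gap_ge0.
case: (\esum_(u in _) _) => [H _ [WH]|//|//].
by rewrite -EFinD; congr EFin; lra.
Qed.

Lemma pow2N_avg_length_le phi : sqnorm phi = 1%E ->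
  (pow2N (avg_length phi) <= pow2NLambda_mean phi)%E.
Proof.
move=> n1; have := pow2NLambda_meanE n1.
have : (0 <= avg_length phi)%E.
  by apply: esum_ge0 => u _; rewrite lee_fin mulr_ge0 ?sqr_ge0.
case: (avg_length phi) => [m _ /(_ m erefl) ->|_ _|//]; last exact: pow2NLambda_mean_ge0.
by rewrite leeDl//; apply: esum_ge0 => u _; rewrite lee_fin jensen_gap_ge0.
Qed.

Lemma base_length_const phi n : sqnorm phi = 1%E ->
  (forall u, phi u != 0 -> size u = n) -> base_length phi = n%:R%:E.
Proof.
move=> /unit_support[v pv] h; rewrite /base_length.
rewrite (_ : [set _ | _ in _] = [set (n%:R)%:E]) ?ereal_sup1//.
apply/seteqP; split => [_ [u /h <- <-]//|_ ->].
by exists v => //; rewrite h.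
Qed.

(** For a finite average m every gap vanishes, so all lengths in the support equal m. An infinite
    average would make the mean 0, although a string of the support contributes a positive term. *)
Lemma pow2N_avg_length_eq phi : sqnorm phi = 1%E ->
  pow2N (avg_length phi) = pow2NLambda_mean phi -> length_eigenstate phi.
Proof.
move=> n1; have [v pv] := unit_support n1; have := pow2NLambda_meanE n1.
have : (0 <= avg_length phi)%E.
  by apply: esum_ge0 => u _; rewrite lee_fin mulr_ge0 ?sqr_ge0.
case: (avg_length phi) => [m _ /(_ m erefl) ->|_ _ /esym|//].
  move=> /esym gap0; have {}gap0 u : jensen_gap phi m u = 0.
    have h0 : (\esum_(u in [set: seq bool]) (jensen_gap phi m u)%:E = 0)%E.
      move: gap0 => /=.
      by case: (\esum_(u in _) _) => [H [H0]|//|//]; congr EFin; lra.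
    suff [] : (jensen_gap phi m u)%:E = 0%E by [].
    by move: u; apply: esum_eq0 h0 => u; rewrite lee_fin jensen_gap_ge0.
  have hs u : phi u != 0 -> size u = size v.
    move=> pu; apply/eqP; rewrite -(eqr_nat R).
    by rewrite !(jensen_gap_eq0 (gap0 _)).
  by exists (size v); split => //; exact: base_length_const.
move=> W0; have [/eqP] : (2 ^- size v * normc (phi v) ^+ 2)%:E = 0%E :> \bar R.
  by move: (v); apply: esum_eq0 W0 => u; rewrite lee_fin pow2NLambda_term_ge0.
 rewrite mulf_eq0 invr_eq0 expf_eq0 pnatr_eq0 andbF /= sqrf_eq0.
by move=> /eqP/eq0_normc/eqP; rewrite (negbTE pv).
Qed.

Lemma length_eigenstate_pow2N phi : sqnorm phi = 1%E -> length_eigenstate phi ->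
  pow2N (base_length phi) = pow2NLambda_mean phi.
Proof.
move=> n1 [n [-> h]]; rewrite /= powR_natN /pow2NLambda_mean.
transitivity ((2 ^- n)%:E * sqnorm phi)%E; first by rewrite n1 mule1.
rewrite /sqnorm -ge0_esumZl ?invr_ge0 ?exprn_ge0//; last first.
  by move=> u; rewrite lee_fin sqr_ge0.
apply: eq_esum => u _; rewrite -EFinM.
by have [->|/h ->//] := eqVneq (phi u) 0; rewrite normc0 expr0n !mulr0.
Qed.

Lemma le_avg_base_length phi : sqnorm phi = 1%E ->
  (avg_length phi <= base_length phi)%E.
Proof.
move=> n1; have [v pv] := unit_support n1.
have ub u : phi u != 0 -> ((size u)%:R%:E <= base_length phi)%E.
  by move=> pu; apply: ereal_sup_ubound; exists u.
(* The string v of the support excludes the value -oo, the supremum of the empty set, and makes L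
   nonnegative; L then bounds a weighted mean of lengths with total weight 1. *)
case: (base_length phi) ub => [L ub|_|/(_ v pv)//]; last exact: leey.
have L0 : 0 <= L by have := ub _ pv; rewrite lee_fin; exact: le_trans.
rewrite -[leRHS]mule1 -n1 /sqnorm -ge0_esumZl//; last first.
  by move=> u; rewrite lee_fin sqr_ge0.
apply: le_esum => u _; rewrite -EFinM lee_fin.
have [->|/ub] := eqVneq (phi u) 0; first by rewrite normc0 expr0n !mulr0.
by rewrite lee_fin => uL; rewrite ler_wpM2r// sqr_ge0.
Qed.

Lemma pow2N_ge0 (x : \bar R) : (0 <= pow2N x)%E.
Proof. by case: x => //= r; rewrite lee_fin powR_ge0. Qed.

Lemma pow2N_anti (x y : \bar R) : (x <= y)%E -> (pow2N y <= pow2N x)%E.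
Proof.
case: x y => [r| |] [s| |] //=; rewrite ?lee_fin ?powR_ge0 ?leey//.
by move=> rs; rewrite ler_powR ?lerN2// ler1n.
Qed.

End Lengths.

(** * The chain of inequalities and its equality case *)

Local Open Scope ereal_scope.

Theorem mainTheorem1 (R : realType) (I : choiceType) (e : I -> seq bool -> R[i])
    (e_ons : orthonormal_system e)
    (e_pf : prefix_free (range e))
    (J : choiceType) (f : J -> seq bool -> R[i])
    (f_basis : orthonormal_basis f (closed_span e)) :
  [/\ \esum_(i in [set: I]) pow2N (base_length (e i))
        <= \esum_(i in [set: I]) pow2N (avg_length (e i)),
      \esum_(i in [set: I]) pow2N (avg_length (e i))
        <= trace_along (@pow2NLambda R) f,
      trace_along (@pow2NLambda R) f <= 1 &
      (\esum_(i in [set: I]) pow2N (base_length (e i))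
         = \esum_(i in [set: I]) pow2N (avg_length (e i)) /\
       \esum_(i in [set: I]) pow2N (avg_length (e i))
         = trace_along (@pow2NLambda R) f)
      <-> (forall i, length_eigenstate (e i))].
Proof.
have [of_ clf] := f_basis.
have [se oe] := e_ons; have [sf _] := of_.
have n1 i : sqnorm (e i) = 1.
  by apply: sqnorm_inner1 => //; rewrite oe eqxx.
have trE : trace_along (@pow2NLambda R) f
    = \esum_(i in [set: I]) pow2NLambda_mean (e i).
  transitivity (\esum_(j in [set: J]) pow2NLambda_mean (f j)).
    by apply: eq_esum => j _; exact: Re_inner_pow2NLambda.
  (* Summing over strings outermost isolates, for each u, the quantity |P|u>|^2, on which e and f
     agree. *)
  have swap (K : choiceType) (g : K -> seq bool -> R[i]) :
      \esum_(k in [set: K]) pow2NLambda_mean (g k)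
      = \esum_(u in [set: seq bool]) ((2 ^- size u)%:E *
          \esum_(k in [set: K]) (normc (g k u) ^+ 2)%:E).
    rewrite esum_exchange; last by move=> k u; rewrite lee_fin pow2NLambda_term_ge0.
    apply: eq_esum => u _; rewrite -ge0_esumZl//.
    by move=> k; rewrite lee_fin sqr_ge0.
  rewrite !swap; apply: eq_esum => u _; congr (_ * _).
  exact: coord_sum_eq.
have base_avg i : pow2N (base_length (e i)) <= pow2N (avg_length (e i)).
  by apply: pow2N_anti; exact: le_avg_base_length.
have avg_mean i : pow2N (avg_length (e i)) <= pow2NLambda_mean (e i).
  exact: pow2N_avg_length_le.
have tr1 : trace_along (@pow2NLambda R) f <= 1 by rewrite trE; exact: kraft.
split => //.
- by apply: le_esum => i _.
- by rewrite trE; apply: le_esum => i _.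
(* The trace is at most 1, hence finite, so equality of the sums forces equality in Jensen's
   inequality for each e_i. *)
rewrite trE; split => [[_ eq_tr] i|eig].
  apply: pow2N_avg_length_eq => //; move: i; apply: le_esum_eq => //.
    by move=> i; exact: pow2N_ge0.
  by rewrite -trE; exact: le_lt_trans tr1 (ltry _).
have bm i : pow2N (base_length (e i)) = pow2NLambda_mean (e i).
  exact: length_eigenstate_pow2N.
(* The average term is squeezed between the base term and the mean, which agree for an
   eigenstate. *)
have am i : pow2N (avg_length (e i)) = pow2NLambda_mean (e i).
  by apply/le_anti; rewrite avg_mean -bm base_avg.
by split; apply: eq_esum => i _; rewrite ?bm ?am.
Qed.
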